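(* Let $p$ be a prime. For every $a,b,c,d\in \mathbb{N}_0$ we have $$N(p^a,p^b,p^c,p^d)= \sum \varphi(p^{x_3})\, \varphi(p^{y_3})\, \varphi(p^{z_3})\, \varphi(p^{t_3})\, F(p^u,p^v),$$ where the sum is over all $$(x_1,x_2,x_3,x_4,x_5,y_1,y_2,y_3,y_4,y_5,z_1,z_2,z_3,z_4,z_5,t_1,t_2,t_3,t_4,t_5)\in\mathbb{N}_0^{20}$$ satisfying the following $10$ conditions: (i) $x_1+x_2+x_3=a$, (ii) $x_3+x_4+x_5=b$, (iii) $y_1+y_2+y_3=\min(x_1,x_4)$, (iv) $y_3+y_4+y_5=x_3+\max(x_1,x_4)$, (v) $z_1+z_2+z_3=c$, (vi) $z_3+z_4+z_5=d$, (vii) $t_1+t_2+t_3=\min(z_1,z_4)$, (viii) $t_3+t_4+t_5=z_3+\max(z_1,z_4)$, (ix) $\min(y_2,y_5)=\min(t_2,t_5)=:u$, (x) $y_3+\max(y_2,y_5)= t_3+ \max(t_2,t_5)=:v$.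
   Context: $\mathbb{N}_0=\{0,1,2,\ldots\}$ and $\mathbb{Z}_n$ is the additive group of residue classes modulo $n$. $N(m,n,r,s)$ denotes the total number of subgroups of the group $\mathbb{Z}_m\times\mathbb{Z}_n\times\mathbb{Z}_r\times\mathbb{Z}_s$. $\varphi$ is Euler's totient function. $F(m,n)$ denotes the number of automorphisms of the group $\mathbb{Z}_m\times\mathbb{Z}_n$. *)

(* Defs.v *)
(* MathComp, with finitely supported big operators from MathComp's classical layer. *)
From HB Require Import structures.
From mathcomp Require Import all_boot all_order all_algebra all_fingroup.
From mathcomp Require Import zify.
From mathcomp Require Import boolp classical_sets functions cardinality fsbigop.

Set Implicit Arguments.
Unset Strict Implicit.
Unset Printing Implicit Defensive.

(* The library group Zp n is the additive group of residues modulo n for every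
   n >= 1, including the trivial group for n = 1 (unlike the type 'Z_1, which
   has two elements).  Zp 0 is a junk (trivial) value. *)

Definition nb_subgroups4 (m n r s : nat) : nat :=
  #|subgroups (finset.setX (finset.setX (finset.setX (Zp m) (Zp n)) (Zp r))
                           (Zp s))|.

Definition nb_automorphisms2 (m n : nat) : nat := #|Aut (finset.setX (Zp m) (Zp n))|.

Notation quint := (nat * nat * nat * nat * nat)%type.

Definition index_set (a b c d : nat) : set (quint * quint * quint * quint) :=
  fun w =>
    let: ((x1, x2, x3, x4, x5), (y1, y2, y3, y4, y5),
          (z1, z2, z3, z4, z5), (t1, t2, t3, t4, t5)) := w in
    (x1 + x2 + x3 = a) /\
    (x3 + x4 + x5 = b) /\
    (y1 + y2 + y3 = minn x1 x4) /\
    (y3 + y4 + y5 = x3 + maxn x1 x4) /\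
    (z1 + z2 + z3 = c) /\
    (z3 + z4 + z5 = d) /\
    (t1 + t2 + t3 = minn z1 z4) /\
    (t3 + t4 + t5 = z3 + maxn z1 z4) /\
    (minn y2 y5 = minn t2 t5) /\
    (y3 + maxn y2 y5 = t3 + maxn t2 t5).

(* u and v are read off the y-side; on index_set the t-side gives the same. *)
Definition summand (p : nat) (w : quint * quint * quint * quint) : nat :=
  let: ((x1, x2, x3, x4, x5), (y1, y2, y3, y4, y5),
        (z1, z2, z3, z4, z5), (t1, t2, t3, t4, t5)) := w in
  let u := minn y2 y5 in
  let v := y3 + maxn y2 y5 in
  totient (p ^ x3) * totient (p ^ y3) * totient (p ^ z3) * totient (p ^ t3)
  * nb_automorphisms2 (p ^ u) (p ^ v).

(* Hence the big operator over index_set is a genuine finite sum, not the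
   default value that the library gives to infinite supports. *)
Lemma finite_index_set (a b c d : nat) : finite_set (index_set a b c d).
Proof.
set I : set nat := [set n | n < (a + b + c + d).+1]%classic.
set Q : set quint := (I `*` I `*` I `*` I `*` I)%classic.
apply: (@sub_finite_set _ _ (Q `*` Q `*` Q `*` Q)%classic).
  move=> [[[[[[[x1 x2] x3] x4] x5] [[[[y1 y2] y3] y4] y5]]
          [[[[z1 z2] z3] z4] z5]] [[[[t1 t2] t3] t4] t5]] /=.
  by move=> h; rewrite /Q /I /=; repeat split => /=; lia.
have fI : finite_set I by exact: finite_II.
by do ![apply: finite_setX].
Qed.

(* Main.v *)
Require Import Defs.
From mathcomp Require Import all_boot all_order all_algebra all_fingroup.
From mathcomp Require Import all_solvable zify.

(* By Goursat's lemma, a subgroup L of an internal direct product H \x K is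
   given by chains A' <= A <= H, B' <= B <= K (the traces and the projections of
   L) and an isomorphism A / A' -> B / B'; equivalently, L / (A' B') is a common
   complement of the images of A and B in (A B) / (A' B').  When H and K are
   cyclic p-groups, the four orders determine the chains, so there are
   phi(p^x3) subgroups L with given orders, where p^x3 = #|A / A'|.  Abelian
   groups of rank at most 2 are classified by order and exponent, and both are
   read off the four orders for L and for (H \x K) / L.  Hence a chain A' <= A
   in a rank 2 abelian p-group is counted by two quintuples, and applying
   Goursat's lemma once more, to (Z_m x Z_n) x (Z_r x Z_s), gives the formula. *)

Set Implicit Arguments.
Unset Strict Implicit.
Unset Printing Implicit Defensive.
Import GroupScope.

(** * Common complements in a finite abelian group *)

Lemma card_compl (gT : finGroupType) (G X L : {group gT}) :
  L \in [complements to X in G] -> (#|X| * #|L|)%N = #|G|.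
Proof. by case/complP=> tiXL <-; rewrite TI_cardMg. Qed.

Lemma compl_quotient_isog (gT : finGroupType) (G X L : {group gT}) :
  abelian G -> L \in [complements to X in G] -> G / X \isog L.
Proof.
move=> cGG /complP[tiXL defG].
have nXL : L \subset 'N(X).
  by apply/cents_norm/(sub_abelian_cent2 cGG); rewrite -defG ?mulG_subl ?mulG_subr.
by rewrite -defG quotientMidl isog_sym quotient_isog.
Qed.

(** Being a complement is a symmetric relation in an abelian group, so [X] and [Y] are both
    isomorphic to [G / L]. *)
Lemma common_compl_isog (gT : finGroupType) (G X Y L : {group gT}) :
  abelian G -> L \in [complements to X in G] -> L \in [complements to Y in G] ->
  X \isog Y.
Proof.
move=> cGG LX LY.
have sw (Z : {group gT}) : L \in [complements to Z in G] -> Z \in [complements to L in G].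
  case/complP=> tiZL defG; apply/complP; rewrite setIC tiZL -defG; split=> //.
  by apply/centC/(sub_abelian_cent2 cGG); rewrite -defG ?mulG_subl ?mulG_subr.
apply: isog_trans (compl_quotient_isog cGG (sw _ LY)).
by rewrite isog_sym compl_quotient_isog ?sw.
Qed.

(** The common complements are the graphs of the isomorphisms from [X] to [Y]. Once one isomorphism
    [f] is fixed, every other is [f] precomposed with a unique automorphism [a] of [X], with graph
    the set of all [x * f (a x)]. *)
Lemma card_common_compl (gT : finGroupType) (G X Y : {group gT}) :
  abelian G -> X \x Y = G ->
  #|[complements to X in G] :&: [complements to Y in G]|
    = if X \isog Y then #|Aut X| else 0%N.
Proof.
move=> cGG /dprodP[_ defG cXY tiXY].
have sXG : X \subset G by rewrite -defG mulG_subl.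
have sYG : Y \subset G by rewrite -defG mulG_subr.
have com x y : x \in G -> y \in G -> x * y = y * x.
  by move=> Gx Gy; apply: (centsP cGG).
case: ifPn => [isoXY | nisoXY]; last first.
  apply: eq_card0 => L; apply: contraNF nisoXY; case/setIP.
  exact: common_compl_isog.
have [f injf imf] := isogP isoXY.
have fY x : x \in X -> f x \in Y by move=> Xx; rewrite -imf mem_morphim.
have cardXY : #|X| = #|Y| := card_isog isoXY.
have cardG : #|G| = (#|X| * #|Y|)%N by rewrite -defG TI_cardMg.
have divXY x y x' y' : x \in X -> x' \in X -> y \in Y -> y' \in Y ->
    x * y = x' * y' -> x = x' /\ y = y'.
  move=> Xx Xx' Yy Yy' eq; split.
    by rewrite -(divgrMid tiXY Xx Yy) eq divgrMid.
  by rewrite -(remgrMid tiXY Xx Yy) eq remgrMid.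
pose graph (a : {perm gT}) := [set x * f (a x) | x in X].
have mem_graph a x y : a \in Aut X -> x \in X -> y \in Y ->
    (x * y \in graph a) = (y == f (a x)).
  move=> Aa Xx Yy; apply/imsetP/eqP => [[x' Xx' eq] | ->]; last by exists x.
  by case: (divXY _ _ _ _ Xx Xx' Yy (fY _ (Aut_closed Aa Xx')) eq) => <-.
have sgraph a : a \in Aut X -> graph a \subset G.
  move=> Aa; apply/subsetP=> _ /imsetP[x Xx ->]; rewrite -defG mem_mulg //.
  by rewrite fY ?Aut_closed.
have group_graph a : a \in Aut X -> group_set (graph a).
  move=> Aa; apply/group_setP; split=> [|_ _ /imsetP[x Xx ->] /imsetP[y Xy ->]].
    apply/imsetP; exists 1; rewrite ?group1 //.
    by rewrite -(autmE Aa) !morph1 mulg1.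
  apply/imsetP; exists (x * y); first by rewrite groupM.
  rewrite -(autmE Aa) morphM // morphM; first last.
  - by rewrite /= Aut_closed.
  - by rewrite /= Aut_closed.
  have fxG : f (autm Aa x) \in G by rewrite (subsetP sYG) ?fY //= Aut_closed.
  rewrite -!mulgA; congr (_ * _); rewrite !mulgA; congr (_ * _).
  by rewrite com // (subsetP sXG).
have gen_graph a : a \in Aut X -> <<graph a>> = graph a.
  by move=> Aa; rewrite -[graph a]/(gval (group (group_graph a Aa))) genGid.
have card_graph a : a \in Aut X -> #|graph a| = #|X|.
  move=> Aa; apply: card_in_imset => x y Xx Xy eq.
  by case: (divXY _ _ _ _ Xx Xy (fY _ (Aut_closed Aa Xx)) (fY _ (Aut_closed Aa Xy)) eq).
have graph_compl a (Z : {group gT}) : a \in Aut X -> Z \subset G -> #|Z| = #|X| ->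
    Z :&: graph a = 1 -> <<graph a>>%G \in [complements to Z in G].
  move=> Aa sZG cardZ ti; apply/complP; rewrite /= gen_graph //; split=> //.
  apply/eqP; rewrite eqEcard mul_subG ?sgraph //=.
  rewrite -[graph a]/(gval (group (group_graph a Aa))) TI_cardMg //= card_graph //.
  by rewrite cardZ cardG -cardXY.
suff -> : [complements to X in G] :&: [complements to Y in G]
            = [set <<graph a>>%G | a in Aut X].
  apply: card_in_imset => a b Aa Ab /(congr1 val) /=.
  rewrite !gen_graph // => eq; apply: (eq_Aut Aa Ab) => x Xx.
  have: x * f (a x) \in graph b by rewrite -eq; apply/imsetP; exists x.
  rewrite mem_graph ?fY ?Aut_closed // => /eqP.
  by move/(injmP injf); apply; rewrite Aut_closed.
apply/setP=> L; apply/idP/imsetP => [/setIP[LX LY] | [a Aa ->]]; last first.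
  apply/setIP; split; apply: graph_compl => //; rewrite -gen_graph //;
    apply/trivgP/subsetP=> z; rewrite /= gen_graph // => /setIP[Zz gz].
    have: z * 1 \in graph a by rewrite mulg1.
    rewrite mem_graph ?group1 // => /eqP/esym/eqP.
    rewrite morph_injm_eq1 ?Aut_closed // -(autmE Aa) morph_injm_eq1 ?injm_autm //.
    by move/eqP->; rewrite group1.
  have: 1 * z \in graph a by rewrite mul1g.
  rewrite mem_graph ?group1 //; rewrite -(autmE Aa) !morph1 => /eqP->.
  exact: group1.
have [tiXL defGX] := complP LX; have [tiYL defGY] := complP LY.
have sLG : L \subset G by rewrite -defGX mulG_subr.
have tiLY : L :&: Y = 1 by rewrite setIC.
have defG' : L * Y = G.
  by rewrite -defGY; apply/centC/(sub_abelian_cent2 cGG).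
have YcL : Y \in [complements to L in G] by apply/complP.
have nLG : L <| G by rewrite -sub_abelian_normal.
(* Since [L * Y = G] with trivial intersection, [r x] is the only element of [Y] with [x * r x] in
   [L]. Thus [L] is the graph of [r], and the automorphism sought is [r] followed by the inverse of
   [f]. *)
pose r x := (remgr L Y x)^-1.
have rM : {in X &, {morph r : x y / x * y}}.
  move=> x y Xx Xy; have [Gx Gy] := (subsetP sXG x Xx, subsetP sXG y Xy).
  rewrite /r (remgrM YcL) // com ?invMg //.
    by rewrite (subsetP sYG) // mem_remgr ?defG'.
  by rewrite (subsetP sYG) // mem_remgr ?defG'.
pose rm := Morphism rM.
have rY x : x \in X -> r x \in Y.
  by move=> Xx; rewrite groupV mem_remgr // defG' (subsetP sXG).
have rL x : x \in X -> x * r x \in L.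
  by move=> Xx; apply: mem_divgr; rewrite defG' (subsetP sXG).
have injr : 'injm rm.
  apply/subsetP=> x /morphpreP[Xx]; rewrite inE => /eqP rx1.
  by rewrite -tiXL inE Xx /= -[x]mulg1 -rx1 rL.
pose g x := invm injf (r x).
have rIf x : x \in X -> r x \in f @* X by rewrite imf; apply: rY.
have gX x : x \in X -> g x \in X.
  by move=> Xx; rewrite -[_ \in X]/(_ \in gval X) -(im_invm injf) mem_morphim ?rIf.
have fg x : x \in X -> f (g x) = r x by move=> Xx; rewrite invmK ?rIf.
have injg : {in X &, injective g}.
  move=> x y Xx Xy /(congr1 f); rewrite !fg //.
  exact: (injmP injr).
have sg : [set g x | x in X] \subset X by apply/subsetP=> _ /imsetP[x Xx ->]; apply: gX.
pose a := perm_in injg sg.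
have aE : {in X, a =1 g} := perm_inE injg sg.
have Aa : a \in Aut X.
  rewrite inE perm_in_on; apply/morphicP=> x y Xx Xy.
  by rewrite !aE ?groupM // /g rM // morphM ?rIf.
exists a => //; apply/val_inj; rewrite /= gen_graph //; apply/esym/eqP.
rewrite eqEcard card_graph //; apply/andP; split.
  by apply/subsetP=> _ /imsetP[x Xx ->]; rewrite aE // fg // rL.
have := card_compl LY; rewrite cardG mulnC => /eqP.
by rewrite eqn_pmul2r ?cardG_gt0 // => /eqP->.
Qed.

(** * Abelian groups of rank at most 2 *)

Lemma abelian_rank2_structure (gT : finGroupType) (G : {group gT}) :
  abelian G -> 'r(G) <= 2 ->
  exists U V : {group gT},
    [/\ U \x V = G, cyclic U, cyclic V & #|V| = exponent G].
Proof.
move=> cGG; rewrite -size_abelian_type //.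
have [b defG tyG] := abelian_structure cGG.
case: (eqsVneq G 1) => [-> _ | ntG].
  by exists 1%G, 1%G; rewrite dprod1g cyclic1 exponent1 cards1.
(* [abelian_type] lists the invariant factors with the largest first, so for nontrivial [G] its head
   is the exponent. *)
have : head 1%N (map order b) = exponent G.
  rewrite tyG /abelian_type; have := cardG_gt0 G; case: #|G| => // n _ /=.
  by case: ifP => [_|]; rewrite /= genGid // cGG ntG.
rewrite -tyG size_map; case: b defG {tyG} => [|x [|y []]] //.
- by rewrite big_nil => eG; rewrite -eG eqxx in ntG.
- rewrite big_seq1 /= => <- <- _; exists 1%G, <[x]>%G.
  by rewrite dprod1g cyclic1 cycle_cyclic.
rewrite !big_cons big_nil dprodg1 dprodC /= => defG <- _.
by exists <[y]>%G, <[x]>%G; rewrite !cycle_cyclic.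
Qed.

Lemma rank_dprod_cyclic_le2 (gT : finGroupType) (G U V : {group gT}) :
  abelian G -> U \x V = G -> cyclic U -> cyclic V -> 'r(G) <= 2.
Proof.
move=> cGG /dprodWY defG /cyclicP[x defU] /cyclicP[y defV].
rewrite -grank_abelian // -defG defU defV.
have -> : <[x]> <*> <[y]> = <<[set x; y]>>.
  by rewrite joing_idl joing_idr.
by rewrite (leq_trans (grank_min _)) // cards2; case: (x != y).
Qed.

Lemma rank_abelian_quotient (gT : finGroupType) (G H : {group gT}) :
  abelian G -> H \subset G -> 'r(G / H) <= 'r(G).
Proof.
move=> cGG sHG; rewrite -!grank_abelian ?quotient_abelian //.
by rewrite quotient_grank // sub_abelian_norm.
Qed.

(** The exponent is the order of one cyclic factor, and dividing the group order by it gives the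
    order of the other. *)
Lemma abelian_rank2_isog (gT rT : finGroupType) (G : {group gT}) (H : {group rT}) :
  abelian G -> abelian H -> 'r(G) <= 2 -> 'r(H) <= 2 ->
  (G \isog H) = (#|G| == #|H|) && (exponent G == exponent H).
Proof.
move=> cGG cHH rG rH; apply/idP/andP => [iso | [/eqP oGH /eqP eGH]].
  by rewrite (card_isog iso) (exponent_isog iso).
have [U [V [defG cU cV oV]]] := abelian_rank2_structure cGG rG.
have [X [Y [defH cX cY oY]]] := abelian_rank2_structure cHH rH.
have oVY : #|V| = #|Y| by rewrite oV oY.
apply: (isog_dprod defG defH).
  rewrite isog_cyclic_card // cX /= -(eqn_pmul2r (cardG_gt0 V)) {1}oVY.
  by rewrite (dprod_card defG) (dprod_card defH) oGH.
by rewrite isog_cyclic_card // cY oVY /=.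
Qed.

Lemma card_Aut_isog (gT rT : finGroupType) (G : {group gT}) (H : {group rT}) :
  G \isog H -> #|Aut G| = #|Aut H|.
Proof.
by case/isogP=> f injf <-; rewrite (card_isog (injm_Aut injf (subxx _))).
Qed.

Lemma exponent_mul_abelian (gT : finGroupType) (H K G : {group gT}) :
  abelian G -> H * K = G -> exponent G = lcmn (exponent H) (exponent K).
Proof.
move=> cGG defG; apply/eqP; rewrite eqn_dvd dvdn_lcm.
rewrite !exponentS -?defG ?mulG_subl ?mulG_subr //= andbT.
apply/exponentP=> _ /mulsgP[x y Hx Ky ->].
rewrite expgMn; last first.
  apply: (centsP cGG); rewrite -defG.
    exact: (subsetP (mulG_subl K H)).
  exact: (subsetP (mulG_subr H K)).
have xe : x ^+ lcmn (exponent H) (exponent K) = 1.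
  by apply/eqP; rewrite -order_dvdn (dvdn_trans (dvdn_exponent Hx)) ?dvdn_lcml.
have ye : y ^+ lcmn (exponent H) (exponent K) = 1.
  by apply/eqP; rewrite -order_dvdn (dvdn_trans (dvdn_exponent Ky)) ?dvdn_lcmr.
by rewrite xe ye mulg1.
Qed.

Lemma Zp_cyclic (n : nat) : cyclic (Zp n).
Proof.
rewrite /Zp; case: ifP => [n1 | _]; last exact: cyclic1.
by rewrite Zp_cycle cycle_cyclic.
Qed.

(** * Goursat's lemma in terms of common complements *)

(** One half of the correspondence. Modulo [A' <*> B'], the condition on [L :&: H] says that [L]
    meets [A] trivially, and the condition on [L * H :&: K] says that [A * L] fills [A <*> B]. The
    other half follows by exchanging [H] and [K]. *)
Lemma compl_quotientP (gT : finGroupType) (G H K A' A B' B L : {group gT}) :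
  abelian G -> H \x K = G -> A' \subset A -> A \subset H ->
  B' \subset B -> B \subset K -> A' <*> B' \subset L -> L \subset A <*> B ->
  reflect (L :&: H = A' /\ L * H :&: K = B)
    ((L / (A' <*> B'))%G
       \in [complements to (A / (A' <*> B'))%G in (A <*> B) / (A' <*> B')]).
Proof.
move=> cGG /dprodP[_ defG _ tiHK] sA'A sAH sB'B sBK sNL sLM.
have sHG : H \subset G by rewrite -defG mulG_subl.
have sKG : K \subset G by rewrite -defG mulG_subr.
have sAG := subset_trans sAH sHG; have sBG := subset_trans sBK sKG.
have sA'G := subset_trans sA'A sAG; have sB'G := subset_trans sB'B sBG.
have defM : A <*> B = A * B by rewrite cent_joinEr // (sub_abelian_cent2 cGG).
have defN : A' <*> B' = A' * B' by rewrite cent_joinEr // (sub_abelian_cent2 cGG).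
have sMG : A <*> B \subset G by rewrite join_subG sAG.
have sLG := subset_trans sLM sMG.
have sNG : A' <*> B' \subset G by rewrite join_subG sA'G.
have nN (Z : {group gT}) : Z \subset G -> Z \subset 'N(A' <*> B').
  by move=> sZG; rewrite cents_norm // (sub_abelian_cent2 cGG).
have sA'L : A' \subset L by apply: subset_trans sNL; rewrite joing_subl.
have tiKA : B :&: H = 1 by apply/trivgP; rewrite /= setIC -tiHK setIS.
have MH : A <*> B :&: H = A by rewrite defM -group_modl // tiKA mulg1.
have NA : A' <*> B' :&: A = A'.
  rewrite defN -group_modl //; apply/eqP; rewrite eqEsubset mulG_subl andbT.
  rewrite mul_subG //; apply: subset_trans (sub1G _); rewrite -tiKA.
  exact: setISS.
have comAL : A * L = L * A by apply/centC; rewrite (sub_abelian_cent2 cGG).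
apply: (iffP complP) => /= [[tiAL defAL] | [LH LHK]].
  split.
    apply/eqP; rewrite eqEsubset subsetI sA'L (subset_trans sA'A sAH) /= andbT.
    have sLHA : L :&: H \subset A by rewrite -MH setSI.
    rewrite -NA subsetI sLHA andbT -quotient_sub1; last first.
      by rewrite nN // subIset ?sLG.
    by rewrite -tiAL subsetI !quotientS ?subsetIl.
  have sMAL : (A <*> B) \subset A * L.
    have : (A <*> B) / (A' <*> B') \subset (A * L) / (A' <*> B').
      by rewrite quotientMl ?nN ?defAL.
    rewrite quotientSK ?nN //; move/subset_trans; apply.
    by rewrite comAL mulgA (mulSGid sNL).
  apply/eqP; rewrite eqEsubset subsetI sBK /= andbT; apply/andP; split.
    rewrite -[gval B]mulg1 -tiHK group_modl //.
    have sLBH : L \subset B * H.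
      apply: subset_trans sLM _; rewrite defM.
      have -> : A * B = B * A by apply/centC; rewrite (sub_abelian_cent2 cGG).
      by rewrite mulgS.
    by rewrite setSI // -{2}(mulGid H) mulgA mulSg.
  apply: subset_trans (joing_subr A B) _; apply: subset_trans sMAL _.
  by rewrite comAL mulgS.
split.
  apply/trivgP; rewrite /= -quotientIG // quotient_sub1 1?setIC.
    by apply: subset_trans (setIS _ sAH) _; rewrite LH joing_subl.
  by rewrite nN // subIset ?sLG.
rewrite -quotientMl ?nN //; suff -> : A * L = A <*> B by [].
apply/eqP; rewrite eqEsubset mul_subG ?joing_subl //=.
suff sBAL : B \subset A * L.
  by rewrite defM (subset_trans (mulgS A sBAL)) // mulgA mulGid.
(* Write [b = l * h] with [l] in [L] and [h] in [H]. Then [h] lies in both [A <*> B] and [H], hence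
   in [A]. *)
apply/subsetP=> b Bb.
have := Bb; rewrite -{1}LHK => /setIP[/mulsgP[l h Ll Hh eb] Kb].
have Mh : h \in A.
  have Mb : b \in A <*> B by rewrite (subsetP (joing_subr A B)).
  by rewrite -MH inE Hh andbT -[h](mulKg l) -eb groupM ?groupV ?(subsetP sLM l Ll).
by rewrite comAL eb mem_mulg.
Qed.

(** These inclusions make [compl_quotientP] applicable. For the upper one, both components of an
    element of [L] lie in the projections of [L]. *)
Lemma dprod_fiberP (gT : finGroupType) (G H K A' A B' B L : {group gT}) :
  abelian G -> H \x K = G -> L \subset G ->
  L :&: H = A' -> L :&: K = B' -> L * K :&: H = A -> L * H :&: K = B ->
  A' <*> B' \subset L /\ L \subset A <*> B.
Proof.
move=> cGG /dprodP[_ defG _ _] sLG LH LK LKH LHK; split.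
  by rewrite join_subG -LH -LK !subsetIl.
apply/subsetP=> l Ll; have := subsetP sLG l Ll; rewrite -defG.
case/mulsgP=> h k Hh Kk el.
have Gh : h \in G by rewrite -defG (subsetP (mulG_subl K H)).
have Gk : k \in G by rewrite -defG (subsetP (mulG_subr H K)).
rewrite el groupM //.
  rewrite (subsetP (joing_subl A B)) // -LKH inE Hh andbT -[h](mulgK k) -el.
  by rewrite mem_mulg ?groupV.
rewrite (subsetP (joing_subr A B)) // -LHK inE Kk andbT -[k](mulgK h).
by rewrite -(centsP cGG h Gh k Gk) -el mem_mulg ?groupV.
Qed.

Definition dprod_fiber (gT : finGroupType) (H K A' A B' B : {group gT}) :=
  [set L : {group gT} |
    [&& L \subset H * K, L :&: H == A', L * K :&: H == A,
        L :&: K == B' & L * H :&: K == B]].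

(** With [N = A' <*> B'] and [M = A <*> B], the map sending [L] to [L / N] is a bijection from the
    fiber to the common complements of [A / N] and [B / N] in [M / N]. As [N] meets [A] in [A'] and
    [B] in [B'], these two factors are isomorphic to [A / A'] and [B / B']. *)
Lemma card_dprod_fiber (gT : finGroupType) (G H K A' A B' B : {group gT}) :
  abelian G -> H \x K = G -> A' \subset A -> A \subset H ->
  B' \subset B -> B \subset K ->
  #|dprod_fiber H K A' A B' B|
    = if A / A' \isog B / B' then #|Aut (A / A')| else 0%N.
Proof.
move=> cGG dG sA'A sAH sB'B sBK; have [_ defG _ tiHK] := dprodP dG.
have sHG : H \subset G by rewrite -defG mulG_subl.
have sKG : K \subset G by rewrite -defG mulG_subr.
have sAG := subset_trans sAH sHG; have sBG := subset_trans sBK sKG.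
have sA'G := subset_trans sA'A sAG; have sB'G := subset_trans sB'B sBG.
have dG' : K \x H = G by rewrite dprodC.
set N := (A' <*> B')%G; set M := (A <*> B)%G.
have sMG : M \subset G by rewrite join_subG sAG.
have sNM : N \subset M by apply: genS; apply: setUSS.
have sNG : N \subset G := subset_trans sNM sMG.
have nN (Z : {group gT}) : Z \subset G -> Z \subset 'N(N).
  by move=> sZG; rewrite cents_norm // (sub_abelian_cent2 cGG).
have defN : N = A' * B' :> {set gT}.
  by rewrite /= cent_joinEr // (sub_abelian_cent2 cGG).
have tiAB : A :&: B = 1 by apply/trivgP; rewrite /= -tiHK setISS.
have NA : N :&: A = A'.
  rewrite defN -group_modl //; apply/eqP; rewrite eqEsubset mulG_subl andbT.
  rewrite mul_subG //; apply: subset_trans (sub1G _); rewrite -tiAB setIC.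
  exact: setIS.
have NB : N :&: B = B'.
  rewrite defN setIC -group_modr //; apply/eqP; rewrite eqEsubset mulG_subr andbT.
  rewrite mul_subG //; apply: subset_trans (sub1G _); rewrite -tiAB setIC.
  exact: setSI.
have isoA : A / A' \isog A / N by move: (second_isog (nN A sAG)); rewrite /= NA.
have isoB : B / B' \isog B / N by move: (second_isog (nN B sBG)); rewrite /= NB.
have dM : (A / N) \x (B / N) = M / N.
  rewrite dprodE.
  - by rewrite -quotientMl ?nN //= (@cent_joinEr _ A B) // (sub_abelian_cent2 cGG).
  - by rewrite quotient_cents // (sub_abelian_cent2 cGG).
  (* The image of [B] does not change when [B] is enlarged to [A' <*> B]. This group contains [N],
     so the quotient commutes with the intersection. *)
  have -> : (B / N)%G = ((A' <*> B) / N)%G.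
    apply/val_inj; rewrite /= (@cent_joinEr _ A' B) ?(sub_abelian_cent2 cGG) // quotientMl ?nN //.
    by rewrite (quotientS1 (joing_subl A' B')) mul1g.
  rewrite -quotientIG; last by rewrite join_subG joing_subl (subset_trans sB'B) ?joing_subr.
  apply: quotientS1; rewrite /= (@cent_joinEr _ A' B) ?(sub_abelian_cent2 cGG) //.
  by rewrite setIC -group_modl // setIC tiAB mulg1 joing_subl.
have cMM : abelian (M / N) by rewrite quotient_abelian // (abelianS sMG).
rewrite (card_Aut_isog isoA) (isog_transl _ isoA) (isog_transr _ isoB).
rewrite -(card_common_compl cMM dM).
suff -> : dprod_fiber H K A' A B' B
    = [set (coset N @*^-1 Q)%G | Q in [complements to (A / N)%G in M / N]
                              :&: [complements to (B / N)%G in M / N]].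
  apply: card_in_imset => Q R _ _ /(congr1 val) /= eqQR; apply/val_inj => /=.
  by rewrite -(cosetpreK Q) eqQR cosetpreK.
have dGK : K \x H = G by rewrite dprodC.
have NC : N = (B' <*> A')%G by apply/val_inj; rewrite /= joingC.
have MC : M = (B <*> A)%G by apply/val_inj; rewrite /= joingC.
apply/setP=> L0; rewrite inE; apply/and5P/imsetP=> [|[Q /setIP[QX QY] ->{L0}]].
  move: L0 => L []; rewrite defG => sLG /eqP LH /eqP LKH /eqP LK /eqP LHK.
  have [sNL sLM] := dprod_fiberP cGG dG sLG LH LK LKH LHK.
  exists (L / N)%G; last first.
    by apply/val_inj; rewrite /= quotientGK // /normal sNL nN.
  apply/setIP; split; first exact/(compl_quotientP cGG dG).
  have sNL' : B' <*> A' \subset L by rewrite joingC.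
  have sLM' : L \subset B <*> A by rewrite joingC.
  rewrite MC NC.
  exact/(compl_quotientP cGG dGK sB'B sBK sA'A sAH sNL' sLM').
set L := (coset N @*^-1 Q)%G.
have defQ : (L / N)%G = Q by apply/val_inj/cosetpreK.
have sNL : N \subset L by exact: sub_cosetpre.
have sLM : L \subset M.
  rewrite -(quotientGK (_ : N <| M)) ?cosetpreSK ?/(normal _ _) ?sNM ?nN //.
  by case/complP: QX => _ <-; rewrite mulG_subr.
rewrite -defQ in QX QY.
have /(compl_quotientP cGG dG sA'A sAH sB'B sBK sNL sLM)[-> ->] := QX.
have sNL' : B' <*> A' \subset L by rewrite joingC.
have sLM' : L \subset B <*> A by rewrite joingC.
rewrite MC NC in QY.
have /(compl_quotientP cGG dGK sB'B sBK sA'A sAH sNL' sLM')[-> ->] := QY.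
by rewrite !eqxx defG (subset_trans sLM).
Qed.

(** * Orders and exponents of a subgroup of a direct product and of its quotient *)

Lemma lcmn_expn (p i j : nat) : lcmn (p ^ i) (p ^ j) = (p ^ maxn i j)%N.
Proof.
wlog le_ij : i j / i <= j.
  by case/orP: (leq_total i j) => le_ij wl; [|rewrite lcmnC maxnC]; apply: wl.
by rewrite (maxn_idPr le_ij); apply/lcmn_idPr/dvdn_exp2l.
Qed.

Lemma cyclic_subgroup_exists (gT : finGroupType) (H : {group gT}) (d : nat) :
  cyclic H -> d %| #|H| -> exists2 S : {group gT}, S \subset H & #|S| = d.
Proof.
case/cyclicP=> x ->; case/dvdnP=> n on; exists <[x ^+ n]>%G; first exact: cycleX.
have xn0 : 0 < n * d by rewrite -on cardG_gt0.
rewrite /= -orderE orderXdiv orderE on ?dvdn_mulr // mulKn //.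
by case: n xn0 {on}.
Qed.

(** If [h = l * k] and [e] is the exponent of [L], then [h ^+ e = k ^+ e] lies in [H :&: K], which
    is trivial. *)
Lemma exponent_dprod_proj (gT : finGroupType) (G H K L : {group gT}) :
  abelian G -> H \x K = G -> L \subset G ->
  exponent (L * K :&: H) %| exponent L.
Proof.
move=> cGG /dprodP[_ defG _ tiHK] sLG.
have sKG : K \subset G by rewrite -defG mulG_subr.
apply/exponentP=> h /setIP[/mulsgP[l k Ll Kk eh] Hh].
have [Gl Gk] := (subsetP sLG l Ll, subsetP sKG k Kk).
apply/set1gP; rewrite -tiHK inE groupX //= eh expgMn; last exact: (centsP cGG).
by rewrite expg_exponent // mul1g groupX.
Qed.

Section DirectProduct.
Variables (gT : finGroupType) (G H K L : {group gT}).
Hypotheses (cGG : abelian G) (dG : H \x K = G) (sLG : L \subset G).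

(** The projection of [L] to [K] has kernel [L :&: H] and image [L * H :&: K]. The proof compares
    two computations of the order of [L <*> H], which is also the product of [H] and that image. *)
Lemma card_dprod_subgroup : #|L| = (#|L :&: H| * #|(L * H :&: K)%g|)%N.
Proof.
have [_ defG _ tiHK] := dprodP dG.
have sHG : H \subset G by rewrite -defG mulG_subl.
have sKG : K \subset G by rewrite -defG mulG_subr.
have defLH : L * H = H * L by apply/centC; rewrite (sub_abelian_cent2 cGG).
have eLH : L <*> H = L * H by rewrite cent_joinEr // (sub_abelian_cent2 cGG).
have eq : H * ((L <*> H) :&: K) = L * H.
  rewrite setIC group_modl ?joing_subr // /= eLH defG; apply/setIidPr.
  by rewrite mul_subG.
have ti : H :&: ((L <*> H) :&: K) = 1 by rewrite setICA tiHK setIC (setIidPl _) ?sub1G.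
rewrite -eLH; apply/eqP; rewrite -(eqn_pmul2r (cardG_gt0 H)) mul_cardG -eq (TI_cardMg ti).
by rewrite -mulnA mulnC [(#|_ :&: K|%G * _)%N]mulnC.
Qed.

(** The exponent of each projection divides that of [L], and [L] is contained in the product of its
    projections. *)
Lemma exponent_dprod_subgroup :
  exponent L = lcmn (exponent (L * K :&: H)) (exponent (L * H :&: K)).
Proof.
have [_ defG _ tiHK] := dprodP dG.
have sHG : H \subset G by rewrite -defG mulG_subl.
have sKG : K \subset G by rewrite -defG mulG_subr.
set A := (L <*> K :&: H)%G; set B := (L <*> H :&: K)%G.
have eA : A = L * K :&: H :> {set gT} by rewrite /= cent_joinEr // (sub_abelian_cent2 cGG).
have eB : B = L * H :&: K :> {set gT} by rewrite /= cent_joinEr // (sub_abelian_cent2 cGG).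
have sAG : A \subset G by rewrite subIset // sHG orbT.
have sBG : B \subset G by rewrite subIset // sKG orbT.
have [_ sLM] := dprod_fiberP cGG dG sLG (erefl (L :&: H)) (erefl (L :&: K)) (esym eA) (esym eB).
have defM : A * B = (A <*> B)%G by rewrite /= (@cent_joinEr _ A B) // (sub_abelian_cent2 cGG).
have cMM : abelian (A <*> B)%G by rewrite (abelianS _ cGG) // join_subG sAG.
have dG' : K \x H = G by rewrite dprodC.
apply/eqP; rewrite eqn_dvd dvdn_lcm (exponent_dprod_proj cGG dG) // (exponent_dprod_proj cGG dG') //=.
by rewrite -eA -eB -(exponent_mul_abelian cMM defM) exponentS.
Qed.

Lemma card_quotient_dprod_factor : #|H / L| = (#|H| %/ #|L :&: H|)%N.
Proof.
have [_ defG _ _] := dprodP dG.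
have sHG : H \subset G by rewrite -defG mulG_subl.
by rewrite card_quotient ?cents_norm ?(sub_abelian_cent2 cGG) // setIC divgI.
Qed.

(** The images of [H] and [K] may intersect in [G / L], but their product is all of it, and this
    determines the exponent. *)
Lemma exponent_dprod_quotient :
  exponent (G / L) = lcmn (exponent (H / L)) (exponent (K / L)).
Proof.
have [_ defG _ _] := dprodP dG.
have sHG : H \subset G by rewrite -defG mulG_subl.
apply: exponent_mul_abelian; first exact: quotient_abelian.
by rewrite /= -defG quotientMl // cents_norm // (sub_abelian_cent2 cGG).
Qed.
End DirectProduct.

(** * Quintuples of exponents *)

(* If x describes L <= H \x K as in goursat_quint below, then #|A / A'| = p ^ mid x,
   and sub_type x (resp. quo_type x) is the pair (u, v), u <= v, such that L
   (resp. (H \x K) / L) is isomorphic to Z_(p^u) x Z_(p^v). *)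
Definition mid (x : quint) : nat := let: (_, _, x3, _, _) := x in x3.

Definition sub_type (x : quint) : nat * nat :=
  let: (x1, _, x3, x4, _) := x in (minn x1 x4, x3 + maxn x1 x4)%N.

Definition quo_type (x : quint) : nat * nat :=
  let: (_, x2, x3, _, x5) := x in (minn x2 x5, x3 + maxn x2 x5)%N.

Definition quint_sums (m n : nat) (x : quint) : bool :=
  let: (x1, x2, x3, x4, x5) := x in
  (x1 + x2 + x3 == m)%N && (x3 + x4 + x5 == n)%N.

(** Each entry of a solution is at most [m + n], so the box searched contains all solutions. *)
Definition quints (m n : nat) : seq quint :=
  let I := iota 0 (m + n).+1 in
  [seq x <- [seq (q, e) | q <- [seq (q, e) | q <- [seq (q, e) | q <-
    [seq (q, e) | q <- I, e <- I], e <- I], e <- I], e <- I] | quint_sums m n x].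

Lemma quints_uniq (m n : nat) : uniq (quints m n).
Proof.
by rewrite filter_uniq //; do !apply: allpairs_uniq; rewrite ?iota_uniq //;
  move=> [? ?] [? ?] _ _ [-> ->].
Qed.

Lemma mem_quints (m n : nat) (x : quint) : (x \in quints m n) = quint_sums m n x.
Proof.
rewrite mem_filter andb_idr //.
case: x => [[[[x1 x2] x3] x4] x5] /andP[/eqP xm /eqP xn].
by rewrite !(allpairs_f pair) // mem_iota; lia.
Qed.

Lemma card_pgroup_le (gT : finGroupType) (p n : nat) (H S : {group gT}) :
  prime p -> #|H| = (p ^ n)%N -> S \subset H ->
  #|S| = (p ^ logn p #|S|)%N /\ logn p #|S| <= n.
Proof.
move=> p_pr oH sSH.
have pS : p.-group S by rewrite (pgroupS sSH) // /pgroup oH pnatX pnat_id.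
rewrite -(card_pgroup pS); split=> //.
by rewrite -(pfactorK n p_pr) -oH dvdn_leq_log ?cardG_gt0 ?cardSg.
Qed.

Lemma addn_min_maxCA (x y z : nat) : (minn x y + (z + maxn x y))%N = (x + z + y)%N.
Proof. lia. Qed.

(** * Goursat's lemma for two cyclic p-groups *)

Section DprodCyclic.
Variables (gT : finGroupType) (p a b : nat) (G H K : {group gT}).
Hypotheses (p_pr : prime p) (cGG : abelian G) (dG : H \x K = G).
Hypotheses (cycH : cyclic H) (cycK : cyclic K).
Hypotheses (oH : #|H| = (p ^ a)%N) (oK : #|K| = (p ^ b)%N).

Let defG : H * K = G. Proof. by case/dprodP: dG. Qed.
Let sHG : H \subset G. Proof. by rewrite -defG mulG_subl. Qed.
Let sKG : K \subset G. Proof. by rewrite -defG mulG_subr. Qed.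

(* x1, x2, x3 are the exponents of #|A'|, #|H : A|, #|A / A'|, and x4, x5 those of
   #|B'|, #|K : B|, with A = L * K :&: H and B = L * H :&: K the projections of L. *)
Definition goursat_quint (L : {group gT}) : quint :=
  let x1 := logn p #|L :&: H| in let x13 := logn p #|L * K :&: H| in
  let x4 := logn p #|L :&: K| in let x34 := logn p #|L * H :&: K| in
  (x1, a - x13, x13 - x1, x4, b - x34)%N.

(** A subgroup of a cyclic group is determined by its order, so the four equalities of groups
    defining the fiber become equalities of exponents of [p]. *)
Lemma goursat_quint_fiber (x1 x2 x3 x4 x5 : nat) (A' A B' B L : {group gT}) :
  (x1 + x2 + x3)%N = a -> (x3 + x4 + x5)%N = b ->
  A \subset H -> A' \subset H -> B \subset K -> B' \subset K ->
  #|A'| = (p ^ x1)%N -> #|A| = (p ^ (x1 + x3))%N ->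
  #|B'| = (p ^ x4)%N -> #|B| = (p ^ (x3 + x4))%N ->
  (L \in dprod_fiber H K A' A B' B)
    = (L \subset G) && (goursat_quint L == (x1, x2, x3, x4, x5)).
Proof.
move=> xa xb sAH sA'H sBK sB'K oA' oA oB' oB.
rewrite inE defG; case: (boolP (L \subset G)) => //= sLG.
have eLH : L <*> H = L * H by rewrite cent_joinEr // (sub_abelian_cent2 cGG).
have eLK : L <*> K = L * K by rewrite cent_joinEr // (sub_abelian_cent2 cGG).
have cyc_eq n (C D S : {group gT}) k : cyclic C -> #|C| = (p ^ n)%N ->
    D \subset C -> S \subset C -> #|S| = (p ^ k)%N ->
  (D == S :> {set gT}) = (logn p #|D| == k).
  move=> cycC oC sDC sSC oS; rewrite (eq_subG_cyclic cycC) // oS.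
  by have [-> _] := card_pgroup_le p_pr oC sDC; rewrite pfactorK // eqn_exp2l ?prime_gt1.
rewrite -eLK -eLH (cyc_eq _ _ _ _ _ cycH oH _ sA'H oA') ?subsetIr //.
rewrite (cyc_eq _ _ _ _ _ cycK oK _ sB'K oB') ?subsetIr //.
rewrite (cyc_eq _ _ _ _ _ cycH oH _ sAH oA) ?subsetIr //.
rewrite (cyc_eq _ _ _ _ _ cycK oK _ sBK oB) ?subsetIr //.
rewrite /goursat_quint -eLK -eLH !xpair_eqE /=.
(* Subtraction on [nat] is truncated. These bounds ensure that [a - x13] and [b - x34] still
   determine the orders of the projections. *)
have [_ leA] := card_pgroup_le p_pr oH (subsetIr (L <*> K) H).
have [_ leB] := card_pgroup_le p_pr oK (subsetIr (L <*> H) K).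
move: (logn p _) (logn p _) (logn p _) (logn p _) leA leB => i j k l /= leA leB.
clear -leA leB xa xb; lia.
Qed.

(** The middle entry is read off [A / A'], while the second sum needs its value for [B / B']. The
    two agree because [L] belongs to its own fiber: a nonempty fiber forces [A / A'] and [B / B'] to
    be isomorphic. *)
Lemma goursat_quint_mem (L : {group gT}) :
  L \subset G -> goursat_quint L \in quints a b.
Proof.
move=> sLG; rewrite mem_quints /goursat_quint.
have eLH : L <*> H = L * H by rewrite cent_joinEr // (sub_abelian_cent2 cGG).
have eLK : L <*> K = L * K by rewrite cent_joinEr // (sub_abelian_cent2 cGG).
rewrite -eLK -eLH.
have [oA leA] := card_pgroup_le p_pr oH (subsetIr (L <*> K) H).
have [oB leB] := card_pgroup_le p_pr oK (subsetIr (L <*> H) K).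
have sA : L :&: H \subset L <*> K :&: H by rewrite setSI ?joing_subl.
have sB : L :&: K \subset L <*> H :&: K by rewrite setSI ?joing_subl.
have [oA' leA'] := card_pgroup_le p_pr oA sA.
have [oB' leB'] := card_pgroup_le p_pr oB sB.
suff : (logn p #|(L <*> K) :&: H| - logn p #|L :&: H|
      = logn p #|(L <*> H) :&: K| - logn p #|L :&: K|)%N by move: leA leB leA' leB';
    rewrite /quint_sums /=; move: (logn p _) (logn p _) (logn p _) (logn p _); clear=> *; lia.
have := card_dprod_fiber cGG dG sA (subsetIr _ _) sB (subsetIr _ _).
case: ifP => [iso _ | _ /cards0_eq/setP/(_ L)]; last first.
  by rewrite !inE defG sLG /= -eLK -eLH !eqxx.
have := card_isog iso.
have nG (X Y : {group gT}) : X \subset G -> Y \subset G -> X \subset 'N(Y).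
  by move=> sXG sYG; rewrite cents_norm // (sub_abelian_cent2 cGG).
have sIG (X Y : {group gT}) : Y \subset G -> X :&: Y \subset G.
  by move=> sYG; rewrite subIset // sYG orbT.
rewrite !card_quotient ?nG ?sIG // -!divgS //= oA oB oA' oB' -!expnB ?prime_gt0 //.
by move=> /eqP; rewrite eqn_exp2l ?prime_gt1 // !pfactorK // => /eqP.
Qed.

(** Subgroups are grouped by their quintuple [x], and each group has [totient (p ^ mid x)] members.
    The hypothesis supplies orders and exponents for both [L] and [G / L], so that one statement
    serves for both members of a chain. *)
Lemma sum_subgroups_dprod_cyclic (F : {group gT} -> nat) (E : quint -> nat) :
  (forall (L : {group gT}) (x : quint), quint_sums a b x -> L \subset G ->
     #|L| = (p ^ ((sub_type x).1 + (sub_type x).2))%N ->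
     exponent L = (p ^ (sub_type x).2)%N ->
     #|G / L| = (p ^ ((quo_type x).1 + (quo_type x).2))%N ->
     exponent (G / L) = (p ^ (quo_type x).2)%N ->
     F L = E x) ->
  (\sum_(L in subgroups G) F L
    = \sum_(x <- quints a b) totient (p ^ mid x) * E x)%N.
Proof.
move=> FE.
(* The inner sum has exactly one term; it is inserted so that the two summations can be
   exchanged. *)
transitivity (\sum_(L in subgroups G) \sum_(x <- quints a b | x == goursat_quint L) F L)%N.
  apply: eq_bigr => L; rewrite inE => sLG.
  rewrite big_const_seq iter_addn (count_uniq_mem _ (quints_uniq a b)).
  by rewrite goursat_quint_mem // muln1 addn0.
rewrite (exchange_big_dep xpredT) //=.
rewrite big_seq [RHS]big_seq; apply: eq_bigr => [[[[[x1 x2] x3] x4] x5]].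
rewrite mem_quints => xab; have /andP[/eqP xa /eqP xb] := xab.
(* Cyclicity provides chains with the orders prescribed by the quintuple; the subgroups with this
   quintuple then form a single [dprod_fiber]. *)
have [|A sAH oA] := @cyclic_subgroup_exists _ H (p ^ (x1 + x3)) cycH.
  by rewrite oH dvdn_exp2l // ?leq_addl ?leq_addr //; clear -xa xb; lia.
have [|A' sA'A oA'] := @cyclic_subgroup_exists _ A (p ^ x1) (cyclicS sAH cycH).
  by rewrite oA dvdn_exp2l // ?leq_addl ?leq_addr //; clear -xa xb; lia.
have [|B sBK oB] := @cyclic_subgroup_exists _ K (p ^ (x3 + x4)) cycK.
  by rewrite oK dvdn_exp2l // ?leq_addl ?leq_addr //; clear -xa xb; lia.
have [|B' sB'B oB'] := @cyclic_subgroup_exists _ B (p ^ x4) (cyclicS sBK cycK).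
  by rewrite oB dvdn_exp2l // ?leq_addl ?leq_addr //; clear -xa xb; lia.
have sA'H := subset_trans sA'A sAH; have sB'K := subset_trans sB'B sBK.
have fibE := goursat_quint_fiber _ xa xb sAH sA'H sBK sB'K oA' oA oB' oB.
have sAG := subset_trans sAH sHG; have sBG := subset_trans sBK sKG.
have p_gt0 := prime_gt0 p_pr.
have oAA' : #|A / A'| = (p ^ x3)%N.
  rewrite card_quotient ?cents_norm ?(sub_abelian_cent2 cGG) ?(subset_trans sA'A) //.
  by rewrite -divgS // oA oA' expnD mulKn ?expn_gt0 ?p_gt0.
have oBB' : #|B / B'| = (p ^ x3)%N.
  rewrite card_quotient ?cents_norm ?(sub_abelian_cent2 cGG) ?(subset_trans sB'B) //.
  by rewrite -divgS // oB oB' addnC expnD mulKn ?expn_gt0 ?p_gt0.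
have isoAB : A / A' \isog B / B'.
  rewrite isog_cyclic_card ?quotient_cyclic ?(cyclicS sAH) ?(cyclicS sBK) //=.
  by rewrite oAA' oBB'.
have := card_dprod_fiber cGG dG sA'A sAH sB'B sBK.
rewrite isoAB card_Aut_cyclic ?quotient_cyclic ?(cyclicS sAH) // oAA' => card_fib.
rewrite -card_fib -sum_nat_const; apply: eq_big => [L | L].
  by rewrite fibE !inE eq_sym.
rewrite inE => /andP[sLG /eqP eqx].
have := fibE L; rewrite sLG -eqx eqxx /= inE.
case/and5P=> _ /eqP LH /eqP LKH /eqP LK /eqP LHK.
have oL : #|L| = (p ^ (x1 + x3 + x4))%N.
  by rewrite (card_dprod_subgroup cGG dG sLG) LH LHK oA' oB -expnD addnA.
apply: FE => //=.
- by rewrite oL addn_min_maxCA.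
- rewrite (exponent_dprod_subgroup cGG dG sLG) LKH LHK.
  rewrite !exponent_cyclic ?(cyclicS sAH) ?(cyclicS sBK) // oA oB lcmn_expn.
  by rewrite [(x1 + x3)%N]addnC -addn_maxr.
- rewrite card_quotient ?cents_norm ?(sub_abelian_cent2 cGG) // -divgS //.
  rewrite -(dprod_card dG) oH oK oL -expnD.
  have -> : (a + b = x1 + x3 + x4 + (minn x2 x5 + (x3 + maxn x2 x5)))%N.
    by clear -xa xb; lia.
  by rewrite expnD mulKn ?expn_gt0 ?p_gt0.
have dG' : K \x H = G by rewrite dprodC.
rewrite (exponent_dprod_quotient cGG dG sLG).
rewrite !exponent_cyclic ?quotient_cyclic //.
rewrite (card_quotient_dprod_factor cGG dG sLG) (card_quotient_dprod_factor cGG dG' sLG).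
rewrite oH oK LH LK oA' oB'.
(* In this form the orders of [H / L] and [K / L] simplify to the powers of [p] with exponents
   [x3 + x2] and [x3 + x5]. *)
have -> : a = (x1 + (x3 + x2))%N by clear -xa; lia.
have -> : b = (x4 + (x3 + x5))%N by clear -xb; lia.
rewrite [in LHS]expnD [X in lcmn _ (X %/ _)]expnD !mulKn ?expn_gt0 ?p_gt0 // lcmn_expn.
by rewrite -addn_maxr.
Qed.
End DprodCyclic.

(** * Chains of two subgroups in a p-group of rank at most 2 *)

(* x describes A in the whole group and y describes A' in A. *)
Definition chains (a b : nat) : seq (quint * quint) :=
  [seq (x, y) | x <- quints a b, y <- quints (sub_type x).1 (sub_type x).2].

Lemma chains_uniq (a b : nat) : uniq (chains a b).
Proof.
apply: allpairs_uniq_dep => [|x _|]; rewrite ?quints_uniq //.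
by move=> [x y] [x' y'] _ _ /= [-> ->].
Qed.

Lemma mem_chains (a b : nat) (w : quint * quint) :
  (w \in chains a b)
    = quint_sums a b w.1 && quint_sums (sub_type w.1).1 (sub_type w.1).2 w.2.
Proof.
case: w => x y /=; apply/allpairsPdep/andP => [[x' [y' [x'ab y'ab [-> ->]]]]|].
  by rewrite -!mem_quints.
by rewrite -!mem_quints => -[xab yab]; exists x, y.
Qed.

(** The number of chains described by one pair of quintuples. *)
Definition weight (p : nat) (w : quint * quint) : nat :=
  (totient (p ^ mid w.1) * totient (p ^ mid w.2))%N.

(** The cyclic count is used twice: in [G] for the larger subgroup, then inside that subgroup for
    the smaller one. *)
Lemma sum_chains (gT : finGroupType) (p a b : nat) (G H K : {group gT})
    (g : nat -> nat -> nat) :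
  prime p -> abelian G -> H \x K = G -> cyclic H -> cyclic K ->
  #|H| = (p ^ a)%N -> #|K| = (p ^ b)%N ->
  (\sum_(A in subgroups G) \sum_(A' in subgroups A)
      g #|A / A'| (exponent (A / A'))
    = \sum_(w <- chains a b) weight p w *
        g (p ^ ((quo_type w.2).1 + (quo_type w.2).2)) (p ^ (quo_type w.2).2))%N.
Proof.
move=> p_pr cGG dG cycH cycK oH oK.
pose g' y := g (p ^ ((quo_type y).1 + (quo_type y).2))%N (p ^ (quo_type y).2)%N.
pose E x := (\sum_(y <- quints (sub_type x).1 (sub_type x).2)
               totient (p ^ mid y) * g' y)%N.
rewrite (sum_subgroups_dprod_cyclic (E := E) p_pr cGG dG cycH cycK oH oK).
  rewrite big_allpairs_dep; apply: eq_bigr => x _; rewrite big_distrr /=.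
  by apply: eq_bigr => y _; rewrite mulnA.
move=> L x _ sLG oL eL _ _; have cLL := abelianS sLG cGG.
have rL : 'r(L) <= 2.
  by rewrite (leq_trans (rankS sLG)) // (rank_dprod_cyclic_le2 cGG dG).
(* [L] need not split along [H] and [K], so a new cyclic decomposition is chosen. The order and
   exponent of [L] fix the orders of its factors as the entries of [sub_type x]. *)
have [U [V [dL cycU cycV oV]]] := abelian_rank2_structure cLL rL.
rewrite eL in oV.
have oU : #|U| = (p ^ (sub_type x).1)%N.
  have := dprod_card dL; rewrite oV oL expnD => /eqP.
  by rewrite eqn_pmul2r ?expn_gt0 ?prime_gt0 // => /eqP.
apply: (sum_subgroups_dprod_cyclic (E := g') p_pr cLL dL cycU cycV oU oV).
by move=> A y _ _ _ _ -> ->.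
Qed.

(** * Counting the subgroups of a product of two groups of rank at most 2 *)

(** Goursat's lemma as a count: the subgroups are partitioned by their two projections and two
    traces. *)
Lemma card_subgroups_dprod (gT : finGroupType) (G H K : {group gT}) :
  abelian G -> H \x K = G ->
  #|subgroups G|
    = (\sum_(A in subgroups H) \sum_(A' in subgroups A)
        \sum_(B in subgroups K) \sum_(B' in subgroups B)
          if A / A' \isog B / B' then #|Aut (A / A')| else 0)%N.
Proof.
move=> cGG dG; have [_ defG _ _] := dprodP dG.
have sHG : H \subset G by rewrite -defG mulG_subl.
have sKG : K \subset G by rewrite -defG mulG_subr.
(* The partition keys must be groups, hence the joins in place of the products used in
   [dprod_fiber]. *)
have eLH (L : {group gT}) : L \in subgroups G -> (L <*> H = L * H)%g.
  by rewrite inE => sLG; rewrite cent_joinEr // (sub_abelian_cent2 cGG).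
have eLK (L : {group gT}) : L \in subgroups G -> (L <*> K = L * K)%g.
  by rewrite inE => sLG; rewrite cent_joinEr // (sub_abelian_cent2 cGG).
rewrite -sum1_card.
rewrite (partition_big (fun L : {group gT} => (L <*> K :&: H)%G) [in subgroups H]) => [|L _]; last first.
  by rewrite inE subsetIr.
apply: eq_bigr => A; rewrite inE => sAH.
rewrite (partition_big (fun L : {group gT} => (L :&: H)%G) [in subgroups A]) => [|L]; last first.
  by case/andP=> _ /eqP <-; rewrite inE /= setSI ?joing_subl.
apply: eq_bigr => A'; rewrite inE => sA'A.
rewrite (partition_big (fun L : {group gT} => (L <*> H :&: K)%G) [in subgroups K]) => [|L _]; last first.
  by rewrite inE subsetIr.
apply: eq_bigr => B; rewrite inE => sBK.
rewrite (partition_big (fun L : {group gT} => (L :&: K)%G) [in subgroups B]) => [|L]; last first.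
  by case/andP=> _ /eqP <-; rewrite inE /= setSI ?joing_subl.
apply: eq_bigr => B'; rewrite inE => sB'B.
rewrite -(card_dprod_fiber cGG dG) // sum1_card; apply: eq_card => L.
rewrite !inE [in LHS]unfold_in defG.
case: (boolP (L \subset G)) => sLG; last by rewrite inE (negbTE sLG).
rewrite -eLH ?inE // -eLK ?inE // sLG /=.
by rewrite -!val_eqE /=; do ![case: (_ == _) => //=].
Qed.

(** [P] is a product of two cyclic groups, one of order [exponent P], so it is isomorphic to the
    corresponding product of residue groups. *)
Lemma card_Aut_abelian_rank2 (gT : finGroupType) (P : {group gT}) :
  abelian P -> 'r(P) <= 2 ->
  #|Aut P| = nb_automorphisms2 (#|P| %/ exponent P) (exponent P).
Proof.
move=> cPP rP; have [U [V [dP cycU cycV oV]]] := abelian_rank2_structure cPP rP.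
have -> : (#|P| %/ exponent P = #|U|)%N by rewrite -(dprod_card dP) oV mulnK ?exponent_gt0.
rewrite -oV; apply: card_Aut_isog.
apply: (isog_dprod dP (setX_dprod (Zp_group #|U|) (Zp_group #|V|))).
  rewrite isog_cyclic_card //= -morphim_pairg1 morphim_cyclic ?Zp_cyclic //=.
  by rewrite card_injm ?injm_pairg1 ?subsetT // card_Zp ?cardG_gt0.
rewrite isog_cyclic_card //= -morphim_pair1g morphim_cyclic ?Zp_cyclic //=.
by rewrite card_injm ?injm_pair1g ?subsetT // card_Zp ?cardG_gt0.
Qed.

Lemma card_subgroups_dprod4_cyclic (gT : finGroupType) (p a b c d : nat)
    (G H K A B C D : {group gT}) :
  prime p -> abelian G -> H \x K = G -> A \x B = H -> C \x D = K ->
  cyclic A -> cyclic B -> cyclic C -> cyclic D ->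
  #|A| = (p ^ a)%N -> #|B| = (p ^ b)%N -> #|C| = (p ^ c)%N -> #|D| = (p ^ d)%N ->
  #|subgroups G| = (\sum_(w <- chains a b) \sum_(w' <- chains c d)
     if quo_type w.2 == quo_type w'.2 then
       weight p w * weight p w' *
         nb_automorphisms2 (p ^ (quo_type w.2).1) (p ^ (quo_type w.2).2)
     else 0)%N.
Proof.
move=> p_pr cGG dG dH dK cycA cycB cycC cycD oA oB oC oD.
have [_ defG _ _] := dprodP dG.
have cHH : abelian H by rewrite (abelianS _ cGG) // -defG mulG_subl.
have cKK : abelian K by rewrite (abelianS _ cGG) // -defG mulG_subr.
have rH := rank_dprod_cyclic_le2 cHH dH cycA cycB.
have rK := rank_dprod_cyclic_le2 cKK dK cycC cycD.
(* The Goursat summand written through orders and exponents alone, as [sum_chains] requires: first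
   for the chains in [K], then for those in [H]. *)
pose h o e o' e' := if (o == o') && (e == e') then nb_automorphisms2 (o %/ e) e else 0%N.
have quo (P S S' : {group gT}) : abelian P -> 'r(P) <= 2 -> S \subset P -> S' \subset S ->
    abelian (S / S') /\ 'r(S / S') <= 2.
  move=> cPP rP sSP sS'S; have cSS := abelianS sSP cPP; split; first exact: quotient_abelian.
  by rewrite (leq_trans (rank_abelian_quotient cSS sS'S)) // (leq_trans (rankS sSP)).
transitivity (\sum_(S in subgroups H) \sum_(S' in subgroups S)
  \sum_(T in subgroups K) \sum_(T' in subgroups T)
     h #|S / S'| (exponent (S / S')) #|T / T'| (exponent (T / T')))%N.
  rewrite (card_subgroups_dprod cGG dG).
  apply: eq_bigr => S; rewrite inE => sSH; apply: eq_bigr => S'; rewrite inE => sS'S.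
  apply: eq_bigr => T; rewrite inE => sTK; apply: eq_bigr => T'; rewrite inE => sT'T.
  have [cS rS] := quo _ _ _ cHH rH sSH sS'S; have [cT rT] := quo _ _ _ cKK rK sTK sT'T.
  by rewrite abelian_rank2_isog // /h card_Aut_abelian_rank2.
under eq_bigr do under eq_bigr do rewrite (sum_chains (h _ _) p_pr cKK dK cycC cycD oC oD).
pose g o e := (\sum_(w <- chains c d) weight p w *
  h o e (p ^ ((quo_type w.2).1 + (quo_type w.2).2)) (p ^ (quo_type w.2).2))%N.
rewrite (sum_chains g p_pr cHH dH cycA cycB oA oB).
apply: eq_bigr => w _; rewrite big_distrr; apply: eq_bigr => w' _ /=.
rewrite /h !eqn_exp2l ?prime_gt1 // expnD mulnK ?expn_gt0 ?prime_gt0 //.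
case: (quo_type w.2) (quo_type w'.2) => [u v] [u' v'] /=; rewrite xpair_eqE.
(* Order [p ^ (u + v)] and exponent [p ^ v] together carry the same information as the pair
   [(u, v)]. *)
have -> : ((u + v == u' + v') && (v == v') = (u == u') && (v == v'))%N by lia.
by case: ifP; rewrite ?mulnA // !muln0.
Qed.

(** * The four residue groups as internal direct factors *)

Lemma abelian_dprod (gT : finGroupType) (G H K : {group gT}) :
  H \x K = G -> abelian H -> abelian K -> abelian G.
Proof. by case/dprodP=> _ <- cHK _ cHH cKK; rewrite abelianM cHH cKK. Qed.

Lemma setX_dprodl (gT rT : finGroupType) (G H K : {group gT}) :
  H \x K = G -> setX H [1 rT] \x setX K 1 = setX G 1.
Proof.
by move=> dG; rewrite -!morphim_pairg1; apply: injm_dprod dG; rewrite ?subsetT ?injm_pairg1.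
Qed.

Lemma cyclic_setXl (gT rT : finGroupType) (H : {group gT}) :
  cyclic H -> cyclic (setX H [1 rT]).
Proof. by move=> cycH; rewrite -morphim_pairg1 morphim_cyclic. Qed.

Lemma cyclic_setXr (gT rT : finGroupType) (H : {group gT}) :
  cyclic H -> cyclic (setX [1 rT] H).
Proof. by move=> cycH; rewrite -morphim_pair1g morphim_cyclic. Qed.

Lemma nb_subgroups4_sum (p a b c d : nat) : prime p ->
  nb_subgroups4 (p ^ a) (p ^ b) (p ^ c) (p ^ d)
    = (\sum_(w <- chains a b) \sum_(w' <- chains c d)
     if quo_type w.2 == quo_type w'.2 then
       weight p w * weight p w' *
         nb_automorphisms2 (p ^ (quo_type w.2).1) (p ^ (quo_type w.2).2)
     else 0)%N.
Proof.
(* Positivity keeps every modulus away from the junk value [Zp 0], so that each [Zp] has the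
   expected order. *)
move=> p_pr; have pX_gt0 n : (0 < p ^ n)%N by rewrite expn_gt0 prime_gt0.
rewrite /nb_subgroups4.
set m := (p ^ a)%N; set n := (p ^ b)%N; set r := (p ^ c)%N; set s := (p ^ d)%N.
pose A := setX_group (setX_group (setX_group (Zp_group m) [1 'Z_n]) [1 'Z_r]) [1 'Z_s].
pose B := setX_group (setX_group (setX_group [1 'Z_m] (Zp_group n)) [1 'Z_r]) [1 'Z_s].
pose C := setX_group (setX_group [1 ('Z_m * 'Z_n)%type] (Zp_group r)) [1 'Z_s].
pose D := setX_group [1 ('Z_m * 'Z_n * 'Z_r)%type] (Zp_group s).
pose H := setX_group (setX_group (setX_group (Zp_group m) (Zp_group n)) [1 'Z_r]) [1 'Z_s].
have dH : A \x B = H by do 2! apply: setX_dprodl; apply: setX_dprod.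
have dG : H \x (C \x D) = setX (setX (setX (Zp m) (Zp n)) (Zp r)) (Zp s).
  rewrite dprodA (setX_dprodl _ (setX_dprod _ _)) /=.
  exact: (setX_dprod (setX_group (setX_group (Zp_group m) (Zp_group n)) (Zp_group r)) (Zp_group s)).
(* The direct product in [dG] is defined only for groups, which yields a group [K] equal to
   [C \x D]. *)
case/dprodP: (dG) => -[_ K _ dK] _ _ _; rewrite dK in dG.
have cycA : cyclic A by do !apply: cyclic_setXl; exact: Zp_cyclic.
have cycB : cyclic B by do 2!apply: cyclic_setXl; apply: cyclic_setXr; exact: Zp_cyclic.
have cycC : cyclic C by apply: cyclic_setXl; apply: cyclic_setXr; exact: Zp_cyclic.
have cycD : cyclic D by apply: cyclic_setXr; exact: Zp_cyclic.
have cHH := abelian_dprod dH (cyclic_abelian cycA) (cyclic_abelian cycB).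
have cKK := abelian_dprod dK (cyclic_abelian cycC) (cyclic_abelian cycD).
have cGG := abelian_dprod dG cHH cKK.
apply: (card_subgroups_dprod4_cyclic p_pr cGG dG dH dK cycA cycB cycC cycD);
  rewrite /= !cardsX ?cards1 card_Zp ?muln1 ?mul1n //; exact: pX_gt0.
Qed.

(** * From lists of quintuples to the index set of the formula *)

(** The filter on [quo_type] expresses conditions (ix) and (x); the remaining eight are the sum
    conditions built into the two lists of chains. *)
Definition index_seq (a b c d : nat) : seq (quint * quint * quint * quint) :=
  [seq (w.1, w.2, w'.1, w'.2) | w <- chains a b,
     w' <- [seq w' <- chains c d | quo_type w.2 == quo_type w'.2]].

Lemma index_seq_uniq (a b c d : nat) : uniq (index_seq a b c d).
Proof.
apply: allpairs_uniq_dep => [|w _|]; rewrite ?filter_uniq ?chains_uniq //.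
by move=> [[x y] [z t]] [[x' y'] [z' t']] _ _ /= [-> -> -> ->].
Qed.

Lemma mem_index_seq (a b c d : nat) (x y z t : quint) :
  (x, y, z, t) \in index_seq a b c d =
  [&& quint_sums a b x, quint_sums (sub_type x).1 (sub_type x).2 y,
      quint_sums c d z, quint_sums (sub_type z).1 (sub_type z).2 t
    & quo_type y == quo_type t].
Proof.
apply/allpairsPdep/idP => [[[x' y'] [[z' t'] []]]|].
  rewrite mem_filter !mem_chains /= => /andP[xs ys] /and3P[eq zs ts] [-> -> -> ->].
  by rewrite xs ys zs ts eq.
case/and5P=> xs ys zs ts eq; exists (x, y), (z, t).
by rewrite mem_filter !mem_chains /= xs ys zs ts eq.
Qed.

(* Imported only here because classical_sets shadows many finset lemmas. *)
From mathcomp Require Import boolp classical_sets functions cardinality fsbigop.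

Lemma index_setE (a b c d : nat) : index_set a b c d = [set` index_seq a b c d]%classic.
Proof.
apply/seteqP; split=> -[[[x y] z] t] /=; rewrite mem_index_seq;
  case: x => [[[[x1 x2] x3] x4] x5]; case: y => [[[[y1 y2] y3] y4] y5];
  case: z => [[[[z1 z2] z3] z4] z5]; case: t => [[[[t1 t2] t3] t4] t5] /=.
- move=> [-> [-> [-> [-> [-> [-> [-> [-> [-> ->]]]]]]]]].
  by rewrite !eqxx.
- move=> /and5P[/andP[/eqP-> /eqP->] /andP[/eqP-> /eqP->] /andP[/eqP-> /eqP->]].
  by move=> /andP[/eqP-> /eqP->] /eqP[-> ->].
Qed.

Theorem corollary1 (p : nat) (a b c d : nat) (p_pr : prime p) :
  nb_subgroups4 (p ^ a) (p ^ b) (p ^ c) (p ^ d) =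
  \big[addn/0]_(w \in index_set a b c d) summand p w.
Proof.
transitivity (\sum_(w <- index_seq a b c d) summand p w)%N; last first.
  (* The enumeration has no repetitions, so the sum over the set is the sum over the list. *)
  by rewrite index_setE (fsbig_seq _ _ (index_seq_uniq a b c d)).
rewrite nb_subgroups4_sum // [RHS]big_allpairs_dep; apply: eq_bigr => -[x y] _.
rewrite big_filter big_mkcond /=; apply: eq_bigr => -[z t] _ /=.
case: ifP => // _; rewrite /weight /= /summand.
case: x => [[[[x1 x2] x3] x4] x5]; case: y => [[[[y1 y2] y3] y4] y5];
  case: z => [[[[z1 z2] z3] z4] z5]; case: t => [[[[t1 t2] t3] t4] t5] /=.
by rewrite !mulnA.
Qed.
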